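(* A commutative ring is a local object of the $(Mono^o,Surj^o)$ factorisation system on $CRings^o$ if and only if it is an integral domain.
   Context: $CRings$ is the category of commutative unital rings. $(Surj,Mono)$ is the unique factorisation system on $CRings$ with left class the surjections $A\to A/I$ and right class the injective ring maps, viewed as $(Mono^o,Surj^o)$ on the opposite category. A ring $K$ is a point of this system if $K\neq 0$ and every quotient map $K\to K/I$ with $I$ a finitely generated ideal and $K/I\neq0$ admits a retraction. A point covering family of $A$ is a family $\{A\to A/I_i\}$ of quotients by finitely generated ideals such that every ring map $A\to K$ with $K$ a point factors through some $A\to A/I_i$. A ring $A$ is a local object if for every point covering family $\{A\to A/I_i\}$ of $A$, at least one $A\to A/I_i$ admits a retraction. *)

(* Defs.v *)
From HB Require Import structures.
From mathcomp Require Import all_boot all_order all_algebra.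

Set Implicit Arguments.
Unset Strict Implicit.
Unset Printing Implicit Defensive.

Import GRing.Theory.

Local Open Scope ring_scope.
Local Open Scope quotient_scope.

(* Commutative unital rings, the zero ring included, are comPzRingType, and
   their morphisms are {rmorphism A -> B}.

   The library's idealr and its ring quotient are restricted to proper ideals
   of nonzero rings.  Here ideals may be improper and A / I may be zero.
   Ideals are boolean predicates, as in the library; with classical choice
   every ideal is of this form. *)

HB.mixin Record isMulAbsorbing (A : comPzRingType) (I : A -> bool) := {
  mul_absorbing_subproof : forall a x, x \in I -> a * x \in I
}.

#[short(type="ideal")]
HB.structure Definition Ideal (A : comPzRingType) :=
  {I of GRing.ZmodClosed A I & isMulAbsorbing A I}.

Section QuotientRing.
Variables (A : comPzRingType) (I : ideal A).

Lemma ideal_mull (a x : A) : x \in I -> a * x \in I.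
Proof. exact: mul_absorbing_subproof. Qed.

(* The additive group is the library's quotient of A by the subgroup I. *)
Definition quot_ring : Type := Quotient.quot I.

HB.instance Definition _ := EqQuotient.on quot_ring.
HB.instance Definition _ := GRing.Zmodule.on quot_ring.

Definition quot_proj (x : A) : quot_ring := \pi_(Quotient.quot I) x.

Definition quot_one : quot_ring := quot_proj 1.
Definition quot_mul (u v : quot_ring) : quot_ring :=
  quot_proj (repr u * repr v).

Lemma quot_proj_eqE (x y : A) : (quot_proj x == quot_proj y) = (x - y \in I).
Proof. by rewrite Quotient.idealrBE. Qed.

Lemma quot_projK (u : quot_ring) : quot_proj (repr u) = u.
Proof. exact: reprK. Qed.

Lemma quot_proj_is_zmod_morphism : zmod_morphism quot_proj.
Proof. exact: (raddfB \pi_(Quotient.quot I)). Qed.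

HB.instance Definition _ :=
  GRing.isZmodMorphism.Build A quot_ring quot_proj quot_proj_is_zmod_morphism.

Lemma quot_projM (x y : A) :
  quot_proj (x * y) = quot_mul (quot_proj x) (quot_proj y).
Proof.
have repr_sub z : z - repr (quot_proj z) \in I.
  by rewrite -quot_proj_eqE quot_projK.
apply/eqP; rewrite quot_proj_eqE.
rewrite -[x * y](addrNK (x * repr (quot_proj y))) -mulrBr -addrA -mulrBl.
by rewrite rpredD // ?[_ * repr (quot_proj y)]mulrC ideal_mull.
Qed.

Lemma quot_mulA : associative quot_mul.
Proof.
move=> u v w; rewrite -[u]quot_projK -[v]quot_projK -[w]quot_projK.
by rewrite -!quot_projM mulrA.
Qed.

Lemma quot_mulC : commutative quot_mul.
Proof.
move=> u v; rewrite -[u]quot_projK -[v]quot_projK.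
by rewrite -!quot_projM mulrC.
Qed.

Lemma quot_mul1 : left_id quot_one quot_mul.
Proof. by move=> u; rewrite -[u]quot_projK -quot_projM mul1r. Qed.

Lemma quot_mulDl : left_distributive quot_mul +%R.
Proof.
move=> u v w; rewrite -[u]quot_projK -[v]quot_projK -[w]quot_projK.
by rewrite -raddfD -!quot_projM mulrDl raddfD.
Qed.

HB.instance Definition _ := GRing.Zmodule_isComPzRing.Build quot_ring
  quot_mulA quot_mulC quot_mul1 quot_mulDl.

Lemma quot_proj_is_monoid_morphism : monoid_morphism quot_proj.
Proof. by split=> // x y; rewrite quot_projM. Qed.

HB.instance Definition _ := GRing.isMonoidMorphism.Build A quot_ring quot_proj
  quot_proj_is_monoid_morphism.

End QuotientRing.

Definition finitely_generated (A : comPzRingType) (I : ideal A) : Prop :=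
  exists (n : nat) (g : 'I_n -> A), forall x : A,
    x \in I <-> exists c : 'I_n -> A, x = \sum_(i < n) c i * g i.

(* Stated on rings; on the opposite category, where the system is
   (Mono^o, Surj^o), this says that f^o has a section. *)
Definition has_retraction (A B : comPzRingType) (f : {rmorphism A -> B}) : Prop :=
  exists r : {rmorphism B -> A}, forall x : A, r (f x) = x.

Definition factors_through (A B K : comPzRingType)
    (f : {rmorphism A -> K}) (p : {rmorphism A -> B}) : Prop :=
  exists g : {rmorphism B -> K}, forall x : A, f x = g (p x).

Definition nonzero_ring (A : comPzRingType) : Prop := (1 : A) <> 0.

Definition is_point (K : comPzRingType) : Prop :=
  nonzero_ring K /\
  forall I : ideal K, finitely_generated I -> nonzero_ring (quot_ring I) ->
    has_retraction (quot_proj I).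

(* The index type J is arbitrary, possibly empty or infinite. *)
Definition point_covering (A : comPzRingType) (J : Type) (I : J -> ideal A) :
    Prop :=
  (forall j : J, finitely_generated (I j)) /\
  forall (K : comPzRingType) (f : {rmorphism A -> K}), is_point K ->
    exists j : J, factors_through f (quot_proj (I j)).

Definition local_object (A : comPzRingType) : Prop :=
  forall (J : Type) (I : J -> ideal A), point_covering I ->
    exists j : J, has_retraction (quot_proj (I j)).

Definition integral_domain (A : comPzRingType) : Prop :=
  nonzero_ring A /\ GRing.integral_domain_axiom A.

(* Main.v *)
Require Import Defs.
From HB Require Import structures.
From mathcomp Require Import all_boot all_order all_algebra.
From mathcomp Require Import boolp.

(** A map that admits a retraction is injective, so a quotient [A -> A / I]
    admits one exactly when [I] is zero.  Two consequences carry the proof.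

    The points are exactly the fields: a nonzero non-unit [x] would generate a
    proper nonzero ideal, and conversely the only proper ideal of a field is
    zero ([is_point_fieldP]).

    A ring is local when every point covering family contains the zero ideal.
    The zero ring has no map to a field, so it is covered by the empty family
    and is not local.  If [x * y = 0], every map to a field kills [x] or [y],
    so [(x)] and [(y)] form a point covering family; in a local object one of
    them must vanish.  Conversely a domain embeds in its fraction field, which
    is a point, and an ideal through whose quotient this embedding factors is
    zero. *)

Set Implicit Arguments.
Unset Strict Implicit.
Unset Printing Implicit Defensive.

Import GRing.Theory.

Local Open Scope ring_scope.

Section QuotientLift.
Variables (A B : comPzRingType) (I : ideal A) (f : {rmorphism A -> B}).
Hypothesis f_kills : forall x, x \in I -> f x = 0.

Definition quot_lift (u : quot_ring I) : B := f (repr u).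

Lemma quot_liftE x : quot_lift (quot_proj I x) = f x.
Proof.
apply/eqP; rewrite -subr_eq0 -rmorphB; apply/eqP/f_kills.
by rewrite -quot_proj_eqE quot_projK.
Qed.

Lemma quot_lift_is_zmod_morphism : zmod_morphism quot_lift.
Proof.
move=> u v; rewrite -[u]quot_projK -[v]quot_projK.
by rewrite -raddfB !quot_liftE rmorphB.
Qed.

Lemma quot_lift_is_monoid_morphism : monoid_morphism quot_lift.
Proof.
split; first by rewrite -(rmorph1 (quot_proj I)) quot_liftE rmorph1.
move=> u v; rewrite -[u]quot_projK -[v]quot_projK.
by rewrite -rmorphM !quot_liftE rmorphM.
Qed.

Lemma factors_through_quot : factors_through f (quot_proj I).
Proof.
pose g : {rmorphism quot_ring I -> B} := HB.pack quot_lift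
  (GRing.isZmodMorphism.Build _ _ _ quot_lift_is_zmod_morphism)
  (GRing.isMonoidMorphism.Build _ _ _ quot_lift_is_monoid_morphism).
by exists g => x; rewrite /= quot_liftE.
Qed.

End QuotientLift.

Lemma quot_proj_eq0 (A : comPzRingType) (I : ideal A) (x : A) :
  x \in I -> quot_proj I x = 0.
Proof.
move=> Ix; rewrite -(raddf0 (quot_proj I)).
by apply/eqP; rewrite quot_proj_eqE subr0.
Qed.

Lemma factors_through_quotP (A K : comPzRingType) (I : ideal A)
    (f : {rmorphism A -> K}) :
  factors_through f (quot_proj I) <-> forall x, x \in I -> f x = 0.
Proof.
split=> [[g fE] x Ix | ]; last exact: factors_through_quot.
by rewrite fE /= quot_proj_eq0 // rmorph0.
Qed.

(** A retraction is a factorisation of the identity through the quotient. *)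
Lemma has_retractionP (A : comPzRingType) (I : ideal A) :
  has_retraction (quot_proj I) <-> forall x, x \in I -> x = 0.
Proof.
apply: iff_trans (factors_through_quotP I (idfun : {rmorphism A -> A})).
by split=> -[g gE]; exists g => x; exact: esym (gE x).
Qed.

Lemma nonzero_quotP (A : comPzRingType) (I : ideal A) :
  nonzero_ring (quot_ring I) <-> 1 \notin I.
Proof.
split=> [nz | nI1 /eqP].
  by apply/negP => I1; apply: nz; rewrite -(rmorph1 (quot_proj I)) /= quot_proj_eq0.
rewrite -(rmorph1 (quot_proj I)) -(raddf0 (quot_proj I)) /= quot_proj_eqE subr0.
exact/negP.
Qed.

Section PrincipalIdeal.
Variables (A : comPzRingType) (x : A).

Definition multiples : A -> bool := fun a => `[< exists c, a = c * x >].

Lemma multiplesP a : reflect (exists c, a = c * x) (a \in multiples).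
Proof. exact: asboolP. Qed.

Lemma multiples_zmod_closed : zmod_closed multiples.
Proof.
split=> [|_ _ /multiplesP[c ->] /multiplesP[d ->]].
  by apply/multiplesP; exists 0; rewrite mul0r.
by apply/multiplesP; exists (c - d); rewrite mulrBl.
Qed.

Lemma multiples_mull (a b : A) : b \in multiples -> a * b \in multiples.
Proof.
move=> /multiplesP[c ->].
by apply/multiplesP; exists (a * c); rewrite mulrA.
Qed.

HB.instance Definition _ :=
  GRing.isZmodClosed.Build A multiples multiples_zmod_closed.
HB.instance Definition _ := isMulAbsorbing.Build A multiples multiples_mull.

Definition principal_ideal : ideal A := Ideal.clone A multiples _.

Lemma principal_idealP a :
  reflect (exists c, a = c * x) (a \in principal_ideal).
Proof. exact: multiplesP. Qed.

Lemma mem_principal_ideal : x \in principal_ideal.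
Proof. by apply/principal_idealP; exists 1; rewrite mul1r. Qed.

Lemma principal_ideal_finitely_generated :
  finitely_generated principal_ideal.
Proof.
exists 1%N, (fun=> x) => a; split=> [/principal_idealP[c ->] | [c ->]].
  by exists (fun=> c); rewrite big_ord1.
by apply/principal_idealP; exists (c ord0); rewrite big_ord1.
Qed.

End PrincipalIdeal.

(** A nonzero [x] generates a nonzero ideal, whose quotient admits no
    retraction; at a point that ideal must therefore be improper, which makes
    [x] invertible. *)
Lemma is_point_fieldP (K : comPzRingType) :
  is_point K <->
  nonzero_ring K /\ forall x : K, x <> 0 -> exists y, y * x = 1.
Proof.
split=> -[nzK HK]; split=> //.
  move=> x nz_x; pose I : ideal K := principal_ideal x.
  have [/principal_idealP[y yx] | nI1] := boolP (1 \in I); first by exists y.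
  case: nz_x; have /has_retractionP : has_retraction (quot_proj I).
    by apply: HK; [exact: principal_ideal_finitely_generated|exact/nonzero_quotP].
  by apply; apply: mem_principal_ideal.
move=> I _ /nonzero_quotP/negP nI1; apply/has_retractionP => x Ix.
apply: contra_notP nI1 => /HK[y <-]; exact: ideal_mull.
Qed.

Lemma point_mulf_eq0 (K : comPzRingType) (x y : K) :
  is_point K -> x * y = 0 -> x = 0 \/ y = 0.
Proof.
move=> /is_point_fieldP[_ invK] xy0; have [->|/eqP nz_x] := eqVneq x 0.
  by left.
have [z zx] := invK _ nz_x.
by right; rewrite -[y]mul1r -zx -mulrA xy0 mulr0.
Qed.

Lemma field_is_point (F : fieldType) : is_point F.
Proof.
apply/is_point_fieldP; split=> [/eqP | x /eqP nz_x]; first by rewrite oner_eq0.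
by exists x^-1; rewrite mulVf.
Qed.

(** The fraction field is built over a ring with an inverse function and a
    boolean predicate for units.  Classical choice provides both, on a copy of
    [A] indexed by the proof that [A] is a domain, since that proof is what
    makes the ring structures on the copy valid. *)
Section FractionField.
Variables (A : comPzRingType) (domA : integral_domain A).

Definition domain_copy : Type := A.

HB.instance Definition _ := GRing.ComPzRing.on domain_copy.

Lemma domain_copy_oner_neq0 : (1 : domain_copy) != 0.
Proof. by case: domA => /eqP. Qed.

HB.instance Definition _ :=
  GRing.PzSemiRing_isNonZero.Build domain_copy domain_copy_oner_neq0.

Definition domain_unit (x : domain_copy) : bool := `[< exists y, y * x = 1 >].

(* The identity on non-units is the value that unit rings prescribe. *)
Definition domain_inv (x : domain_copy) : domain_copy :=
  if pselect (exists y, y * x = 1) is left ex then projT1 (cid ex) else x.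

Lemma domain_mulVr : {in domain_unit, left_inverse 1 domain_inv *%R}.
Proof.
move=> x /asboolP ux; rewrite /domain_inv.
by case: pselect => // ex; case: cid.
Qed.

Lemma domain_unitP (x y : domain_copy) : y * x = 1 -> domain_unit x.
Proof. by move=> yx; apply/asboolP; exists y. Qed.

Lemma domain_inv_out : {in [predC domain_unit], domain_inv =1 id}.
Proof.
move=> x /negP nux; rewrite /domain_inv; case: pselect => // ex.
by case: nux; apply/asboolP.
Qed.

HB.instance Definition _ := GRing.ComNzRing_hasMulInverse.Build domain_copy
  domain_mulVr domain_unitP domain_inv_out.

Lemma domain_mulf_eq0 : GRing.integral_domain_axiom domain_copy.
Proof. by case: domA. Qed.

HB.instance Definition _ :=
  GRing.ComUnitRing_isIntegral.Build domain_copy domain_mulf_eq0.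

Lemma exists_injective_to_point :
  exists (K : comPzRingType) (f : {rmorphism A -> K}),
    is_point K /\ injective f.
Proof.
exists {fraction domain_copy}.
exists (@tofrac domain_copy : {rmorphism domain_copy -> _}).
split; first exact: field_is_point.
by move=> x y /eqP; rewrite /= tofrac_eq => /eqP.
Qed.

End FractionField.

Lemma local_object_nonzero (A : comPzRingType) :
  local_object A -> nonzero_ring A.
Proof.
move=> locA A0; have [|[]] := locA void (fun=> principal_ideal 0).
split=> [[]|K f [nzK _]].
by case: nzK; rewrite -(rmorph1 f) A0 rmorph0.
Qed.

Lemma point_covering_zero_divisors (A : comPzRingType) (x y : A) :
  x * y = 0 ->
  point_covering (fun b : bool => principal_ideal (if b then x else y)).
Proof.
move=> xy0; split=> [b|K f ptK]; first exact: principal_ideal_finitely_generated.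
have kills z : f z = 0 -> factors_through f (quot_proj (principal_ideal z)).
  move=> fz0; apply/factors_through_quotP => _ /principal_idealP[c ->].
  by rewrite rmorphM fz0 mulr0.
have /(point_mulf_eq0 ptK)[/kills|/kills] : f x * f y = 0.
- by rewrite -rmorphM xy0 rmorph0.
- by exists true.
- by exists false.
Qed.

Theorem proposition89 (A : comPzRingType) : local_object A <-> integral_domain A.
Proof.
split=> [locA | domA J I [_ coverI]].
  split=> [|x y xy0]; first exact: local_object_nonzero.
  have [b /has_retractionP/(_ _ (mem_principal_ideal _))] :=
    locA _ _ (point_covering_zero_divisors xy0).
  by case: b => ->; rewrite eqxx ?orbT.
have [K [f [ptK f_inj]]] := exists_injective_to_point domA.
have [j /factors_through_quotP fI0] := coverI K f ptK.
exists j; apply/has_retractionP => x Ix.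
by apply: f_inj; rewrite rmorph0 fI0.
Qed.
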